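(* For every integer $k\geq 1$, let $$P_k(x,q)=\sum_{n\geq k}\sum_{\pi\in P_{n,k}}x^nq^{\mathrm{swrec}(\pi)}$$ (as a formal power series in $x$ with coefficients polynomials in $q$). Then $$P_k(x,q)=\prod_{i=1}^{k}\frac{x\,q^i\,q^{(k+1-i)(k-i)}}{1-ix\prod_{j=i+1}^{k}q^j}.$$
   Context: A partition of $[n]=\{1,\dots,n\}$ into exactly $k$ blocks is a collection $\{B_1,\dots,B_k\}$ of nonempty, pairwise disjoint subsets with union $[n]$, with blocks listed so that $\min B_1<\min B_2<\cdots<\min B_k$. Its canonical sequential form is the word $\pi=\pi_1\pi_2\cdots\pi_n$ where $i\in B_{\pi_i}$. $P_{n,k}$ denotes the set of partitions of $[n]$ with exactly $k$ blocks, identified with their canonical sequential forms. In a word $\pi=\pi_1\cdots\pi_n$, the entry $\pi_i$ is a record (at position $i$) if $\pi_i>\pi_j$ for all $j<i$. The statistic $\mathrm{swrec}(\pi)$ is the sum, over all records $\pi_i$ of $\pi$, of $i\cdot\pi_i$ (position times value); e.g. $\mathrm{swrec}(121132)=1\cdot1+2\cdot2+3\cdot5=20$. *)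

(* Defs.v *)
From HB Require Import structures.
From mathcomp Require Import all_boot all_order all_algebra.
From mathcomp Require Import boolp.

Set Implicit Arguments.
Unset Strict Implicit.
Unset Printing Implicit Defensive.

Import GRing.Theory.
Local Open Scope ring_scope.

(* Formal power series; the record wrapper keeps the Cauchy product apart from
   the pointwise ring structure on functions. *)
Record fps (R : Type) := Fps { fps_coef : nat -> R }.

Lemma fpsP (R : Type) (f g : fps R) :
  (forall n, fps_coef f n = fps_coef g n) <-> f = g.
Proof.
split=> [|-> //]; case: f => f; case: g => g /= fg.
by congr Fps; apply/funext.
Qed.

HB.instance Definition _ (R : Type) := gen_eqMixin (fps R).
HB.instance Definition _ (R : Type) := gen_choiceMixin (fps R).

Section FpsRing.
Variable R : comNzRingType.
Implicit Types (a : R) (f g h : fps R).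

Definition fpsC a : fps R := Fps (fun n => if n == 0%N then a else 0).
Definition fpsX : fps R := Fps (fun n => (n == 1%N)%:R).

Definition add_fps f g : fps R := Fps (fun n => fps_coef f n + fps_coef g n).
Definition opp_fps f : fps R := Fps (fun n => - fps_coef f n).
Definition mul_fps f g : fps R :=
  Fps (fun n => \sum_(i < n.+1) fps_coef f i * fps_coef g (n - i)%N).

Fact add_fpsA : associative add_fps.
Proof. by move=> f g h; apply/fpsP => n /=; rewrite addrA. Qed.

Fact add_fpsC : commutative add_fps.
Proof. by move=> f g; apply/fpsP => n /=; rewrite addrC. Qed.

Fact add_0fps : left_id (fpsC 0) add_fps.
Proof. by move=> f; apply/fpsP => n /=; rewrite if_same add0r. Qed.

Fact add_fpsN : left_inverse (fpsC 0) opp_fps add_fps.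
Proof. by move=> f; apply/fpsP => n /=; rewrite if_same addNr. Qed.

HB.instance Definition _ :=
  GRing.isZmodule.Build (fps R) add_fpsA add_fpsC add_0fps add_fpsN.

Fact coef_mul_fps_rev f g n :
  fps_coef (mul_fps f g) n =
  \sum_(i < n.+1) fps_coef f (n - i)%N * fps_coef g i.
Proof.
rewrite /= (reindex_inj rev_ord_inj) /=.
by apply: eq_bigr => j _; rewrite (sub_ordK j).
Qed.

Fact mul_fpsA : associative mul_fps.
Proof.
move=> p q r; apply/fpsP=> i; rewrite [RHS]coef_mul_fps_rev.
rewrite -[LHS]/(\sum_(j < i.+1) fps_coef p j * fps_coef (mul_fps q r) (i - j)).
pose coef3 j k := fps_coef p j * (fps_coef q (i - j - k)%N * fps_coef r k).
transitivity (\sum_(j < i.+1) \sum_(k < i.+1 | (k <= i - j)%N) coef3 j k).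
  apply: eq_bigr => j _; rewrite [fps_coef (mul_fps _ _) _]coef_mul_fps_rev.
  rewrite big_distrr /=.
  by rewrite (big_ord_narrow_leq (leq_subr _ _)).
rewrite (exchange_big_dep predT) //=; apply: eq_bigr => k _.
transitivity (\sum_(j < i.+1 | (j <= i - k)%N) coef3 j k).
  apply: eq_bigl => j; rewrite -ltnS -(ltnS j) -!subSn ?leq_ord //.
  by rewrite -subn_gt0 -(subn_gt0 j) -!subnDA addnC.
rewrite (big_ord_narrow_leq (leq_subr _ _)) big_distrl /=.
by apply: eq_bigr => j _; rewrite /coef3 -!subnDA addnC mulrA.
Qed.

Fact mul_fpsC : commutative mul_fps.
Proof.
move=> f g; apply/fpsP => n; rewrite coef_mul_fps_rev /=.
by apply: eq_bigr => i _; rewrite mulrC.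
Qed.

Fact mul_1fps : left_id (fpsC 1) mul_fps.
Proof.
move=> f; apply/fpsP => n; rewrite /= big_ord_recl subn0 mul1r.
by rewrite big1 ?addr0 // => j _; rewrite mul0r.
Qed.

Fact mul_fpsDl : left_distributive mul_fps +%R.
Proof.
move=> f g h; apply/fpsP => n; rewrite /= -big_split /=.
by apply: eq_bigr => i _; rewrite mulrDl.
Qed.

Fact fps1_neq0 : fpsC 1 != 0.
Proof. by apply/eqP => /fpsP/(_ 0%N)/eqP; rewrite /= oner_eq0. Qed.

HB.instance Definition _ :=
  GRing.Zmodule_isComNzRing.Build (fps R)
    mul_fpsA mul_fpsC mul_1fps mul_fpsDl fps1_neq0.

Definition unit_fps : pred (fps R) := fun f => `[< exists g, g * f = 1 >].
Definition inv_fps f : fps R :=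
  if pselect (exists g, g * f = 1) is left ex_g then projT1 (cid ex_g) else f.

Fact mul_Vfps : {in unit_fps, left_inverse 1 inv_fps *%R}.
Proof.
move=> f /asboolP; rewrite /inv_fps; case: pselect => // ex_g _.
by case: (cid ex_g).
Qed.

Fact unit_fpsPl f g : g * f = 1 -> unit_fps f.
Proof. by move=> gf1; apply/asboolP; exists g. Qed.

Fact inv_fps_out : {in [predC unit_fps], inv_fps =1 id}.
Proof.
move=> f /negP nuf; rewrite /inv_fps; case: pselect => // ex_g.
by case: nuf; apply/asboolP.
Qed.

HB.instance Definition _ :=
  GRing.ComNzRing_hasMulInverse.Build (fps R) mul_Vfps unit_fpsPl inv_fps_out.

Lemma coef_fpsM f g n : fps_coef (f * g) n =
  \sum_(i < n.+1) fps_coef f i * fps_coef g (n - i)%N.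
Proof. by []. Qed.

Lemma geom_fps a : Fps (fun n => a ^+ n) * (1 - fpsC a * fpsX) = 1.
Proof.
have cE n : fps_coef (1 - fpsC a * fpsX) n =
    (n == 0%N)%:R - a * (n == 1%N)%:R.
  rewrite -[LHS]/(fps_coef (fpsC 1) n - fps_coef (fpsC a * fpsX) n).
  rewrite coef_fpsM big_ord_recl subn0 big1 ?addr0 => [|j _]; last first.
    by rewrite mul0r.
  by rewrite /=; case: eqP.
apply/fpsP => -[|n]; rewrite coef_mul_fps_rev.
  by rewrite big_ord1 cE /= mulr0 subr0 mul1r.
under eq_bigr do rewrite cE.
rewrite !big_ord_recl big1 /= => [|j _]; last by rewrite mulr0 subr0 mulr0.
by rewrite mulr0 subr0 !mulr1 addr0 subSS !subn0 sub0r mulrN -exprSr addrN.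
Qed.

Lemma geom_fps_unit a : 1 - fpsC a * fpsX \is a GRing.unit.
Proof. exact: unit_fpsPl (geom_fps a). Qed.

End FpsRing.

Arguments fpsX {R}.

(* The ground set [n] is represented by 'I_n, i standing for i + 1. *)

Definition partitions (n k : nat) : {set {set {set 'I_n}}} :=
  [set P | partition P [set: 'I_n] && (#|P| == k)].

Definition block_min (n : nat) (B : {set 'I_n}) : nat :=
  \big[minn/n]_(i in B) nat_of_ord i.

Definition blocks (n : nat) (P : {set {set 'I_n}}) : seq {set 'I_n} :=
  sort (fun A B => (block_min A <= block_min B)%N) (enum P).

Definition canonical_form (n : nat) (P : {set {set 'I_n}}) : seq nat :=
  [seq (index (pblock P i) (blocks P)).+1 | i <- enum 'I_n].

(* Words are indexed from 0: nth 0 w i is the letter at position i + 1. *)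
Definition is_record (w : seq nat) (i : nat) : bool :=
  [forall j : 'I_i, nth 0%N w j < nth 0%N w i]%N.

Definition swrec (w : seq nat) : nat :=
  (\sum_(i < size w | is_record w i) i.+1 * nth 0 w i)%N.

Definition swrec_gf (k : nat) : fps {poly int} :=
  Fps (fun n => if (k <= n)%N
                then \sum_(P in partitions n k) 'X^(swrec (canonical_form P))
                else 0).

(* Main.v *)
Require Import Defs.
From HB Require Import structures.
From mathcomp Require Import all_boot all_order all_algebra.
From mathcomp Require Import zify ring.

Import GRing.Theory.
Local Open Scope ring_scope.

(** Canonical forms are exactly the restricted growth words, and such a word is
    determined by which of its letters coincide.  Deleting the last letter of a
    word of length [n + 1] with [k] blocks leaves either a word with [k - 1]
    blocks (the deleted letter was a record, contributing [(n + 1) * k]) or a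
    word with [k] blocks (it was one of the [k] old letters).  Hence
    [P_k(x, q) * (1 - k x) = x q^k P_(k-1)(x q^k, q)], and the product satisfies
    the same recursion. *)

(** * Substitution of a multiple of the variable in a power series *)

Section FpsScale.
Variable R : comNzRingType.
Implicit Types (a : R) (f g : fps R).

(** The substitution of [a * x] for [x]; with [a] equal to q^k it turns P_(k-1)(x, q) into P_(k-1)(x
    q^k, q). *)
Definition fps_scale a f : fps R := Fps (fun n => a ^+ n * fps_coef f n).

Fact fps_scale_is_zmod_morphism a : zmod_morphism (fps_scale a).
Proof. by move=> f g; apply/fpsP => n; rewrite /= mulrDr mulrN. Qed.

Fact fps_scale_is_monoid_morphism a : monoid_morphism (fps_scale a).
Proof.
split=> [|f g]; apply/fpsP => n.
  by case: n => [|n] /=; rewrite ?mulr0 ?mulr1.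
rewrite /= mulr_sumr; apply: eq_bigr => i _.
by rewrite mulrACA -exprD subnKC // -ltnS.
Qed.

HB.instance Definition _ a :=
  GRing.isZmodMorphism.Build (fps R) (fps R) (fps_scale a)
    (fps_scale_is_zmod_morphism a).
HB.instance Definition _ a :=
  GRing.isMonoidMorphism.Build (fps R) (fps R) (fps_scale a)
    (fps_scale_is_monoid_morphism a).

Lemma fpsC_is_zmod_morphism : zmod_morphism (@fpsC R).
Proof. by move=> a b; apply/fpsP => -[|n] //=; rewrite subr0. Qed.

Lemma coef_fpsCM a f n : fps_coef (fpsC a * f) n = a * fps_coef f n.
Proof.
by rewrite coef_fpsM big_ord_recl subn0 big1 ?addr0 // => i _; rewrite mul0r.
Qed.

Lemma fpsC_is_monoid_morphism : monoid_morphism (@fpsC R).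
Proof.
split=> // a b; apply/fpsP => n; rewrite coef_fpsCM /=.
by case: eqP => // _; rewrite mulr0.
Qed.

HB.instance Definition _ :=
  GRing.isZmodMorphism.Build R (fps R) (@fpsC R) fpsC_is_zmod_morphism.
HB.instance Definition _ :=
  GRing.isMonoidMorphism.Build R (fps R) (@fpsC R) fpsC_is_monoid_morphism.

Lemma coef_fpsD f g n : fps_coef (f + g) n = fps_coef f n + fps_coef g n.
Proof. by []. Qed.

Lemma coef_fpsXM f n :
  fps_coef (fpsX * f) n = if n is m.+1 then fps_coef f m else 0.
Proof.
case: n => [|n]; first by rewrite coef_fpsM big_ord1 mul0r.
rewrite coef_fpsM !big_ord_recl big1 => [|i _]; last by rewrite mul0r.
by rewrite mul0r add0r mul1r addr0 subSS subn0.
Qed.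

Lemma fps_scaleC a b : fps_scale a (fpsC b) = fpsC b.
Proof. by apply/fpsP => -[|n] /=; rewrite ?mul1r ?mulr0. Qed.

Lemma fps_scaleX a : fps_scale a fpsX = fpsC a * fpsX.
Proof.
apply/fpsP => n; rewrite coef_fpsCM /=.
by case: eqP => [->|_]; rewrite ?expr1 // !mulr0.
Qed.

End FpsScale.

(** * Restricted growth words and the effect of a last letter on [swrec] *)

Section RestrictedGrowth.
Local Open Scope nat_scope.
Implicit Types (w : seq nat) (a k n : nat).

Definition max_letter w := \max_(a <- w) a.

(** The maximum of the empty prefix is 0, which forces the first letter to be 1. *)
Definition growth_word w :=
  all (fun m => 0 < nth 0 w m <= (max_letter (take m w)).+1) (iota 0 (size w)).

Lemma max_letter_rcons w a : max_letter (rcons w a) = maxn (max_letter w) a.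
Proof. by rewrite /max_letter -cats1 big_cat big_seq1. Qed.

Lemma leq_max_letter w a : a \in w -> a <= max_letter w.
Proof. by move=> wa; rewrite /max_letter (big_rem a) //= leq_maxl. Qed.

Lemma growth_word_rcons w a :
  growth_word (rcons w a) = growth_word w && (0 < a <= (max_letter w).+1).
Proof.
rewrite /growth_word size_rcons -[(size w).+1]addn1 iotaD all_cat /= andbT.
rewrite nth_rcons ltnn eqxx -cats1 take_size_cat //; congr andb.
apply: eq_in_all => m; rewrite mem_iota /= add0n => lt_m.
by rewrite nth_cat lt_m takel_cat // ltnW.
Qed.

(** The running maximum rises by at most one per letter, so no value is skipped. *)
Lemma growth_word_mem w a :
  growth_word w -> (a \in w) = (0 < a <= max_letter w).
Proof.
elim/last_ind: w => [|w b IHw]; first by rewrite /max_letter big_nil; case: a.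
rewrite growth_word_rcons max_letter_rcons mem_rcons inE => /andP[/IHw-> hb].
by lia.
Qed.

(** Induction on the last letter: an old letter is determined by a position where it already occurs,
    and a new one must be the maximum plus one. *)
Lemma growth_word_eq w1 w2 :
    size w1 = size w2 -> growth_word w1 -> growth_word w2 ->
    (forall i j, i < size w1 -> j < size w1 ->
      (nth 0 w1 i == nth 0 w1 j) = (nth 0 w2 i == nth 0 w2 j)) ->
  w1 = w2.
Proof.
elim/last_ind: w1 w2 => [|w1 a IHw] w2; first by case: w2.
case/lastP: w2 => [|w2 b]; rewrite !size_rcons //.
move=> [eq_sz]; rewrite !growth_word_rcons => /andP[g1 a1] /andP[g2 b2] ker.
have eq_w : w1 = w2.
  apply: IHw => // i j lt_i lt_j; have := ker i j (ltnW lt_i) (ltnW lt_j).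
  by rewrite !nth_rcons -!eq_sz lt_i lt_j.
subst w2; congr rcons.
have mem_eq c : c \in w1 -> (a == c) = (b == c).
  move=> /(nthP 0)[j lt_j <-]; have := ker (size w1) j (ltnSn _) (ltnW lt_j).
  by rewrite !nth_rcons lt_j ltnn eqxx.
have [w1a|w1'a] := boolP (a \in w1).
  by have /esym := mem_eq a w1a; rewrite eqxx => /eqP.
have w1'b : b \notin w1.
  apply: contraNN w1'a => w1b; have := mem_eq b w1b.
  by rewrite eqxx => /eqP->.
rewrite growth_word_mem // in w1'a; rewrite growth_word_mem // in w1'b; lia.
Qed.

(** Splitting by the last letter, either the new letter [k] or one of the [k] old ones, makes the
    two halves the two terms of the recursion. *)
Fixpoint growth_words n k : seq (seq nat) :=
  if n is m.+1 then
    (if k is l.+1 then [seq rcons w k | w <- growth_words m l] else [::])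
    ++ [seq rcons w a | w <- growth_words m k, a <- iota 1 k]
  else if k is 0 then [:: [::]] else [::].

Lemma growth_wordsSS n k :
  growth_words n.+1 k.+1 =
  [seq rcons w k.+1 | w <- growth_words n k]
  ++ [seq rcons w a | w <- growth_words n k.+1, a <- iota 1 k.+1].
Proof. by []. Qed.

Lemma mem_growth_words n k w :
  (w \in growth_words n k) =
  [&& growth_word w, size w == n & max_letter w == k].
Proof.
elim: n k w => [|n IHn] k w.
  case: w => [|a w]; last by rewrite andbF; case: k.
  by rewrite /max_letter big_nil; case: k.
case/lastP: w => [|w b].
  rewrite andbF mem_cat /=; apply/norP; split.
    by case: k => // k; apply/mapP => -[[]].
  by apply/allpairsP => -[[[|? ?] ?] []].
rewrite size_rcons eqSS growth_word_rcons max_letter_rcons mem_cat.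
have -> : (rcons w b \in
             [seq rcons w0 a | w0 <- growth_words n k, a <- iota 1 k])
          = (w \in growth_words n k) && (0 < b <= k).
  apply/allpairsP/idP => [[[w' a] /= [w'_in a_in] /rcons_inj[-> ->]]|].
    by rewrite w'_in; move: a_in; rewrite mem_iota; lia.
  case/andP=> w_in b_in; exists (w, b).
  by rewrite /= mem_iota w_in; split=> //; lia.
rewrite IHn; case: k => [|k]; first by rewrite in_nil; lia.
have -> : (rcons w b \in [seq rcons w0 k.+1 | w0 <- growth_words n k])
          = (w \in growth_words n k) && (b == k.+1).
  apply/mapP/idP => [[w' w'_in /rcons_inj[-> ->]]|]; first by rewrite w'_in eqxx.
  by case/andP=> w_in /eqP->; exists w.
by rewrite IHn; lia.
Qed.

Lemma growth_words_uniq n k : uniq (growth_words n k).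
Proof.
elim: n k => [|n IHn] k; first by case: k.
rewrite /= cat_uniq [X in _ && (_ && X)]allpairs_uniq ?iota_uniq //; last first.
  by move=> [w a] [w' a'] _ _ /= /rcons_inj.
rewrite andbT.
case: k => [|k]; first by apply/hasPn => w.
rewrite map_inj_uniq ?IHn => [|w w' /rcons_inj[]//].
(* The halves are disjoint: deleting the last letter leaves words with different maxima. *)
apply/hasPn => w /allpairsP[[w' a] /= [w'_in a_in ->]].
apply/mapP => -[w'' w''_in /rcons_inj[eq_w _]]; subst w''.
by move: w'_in w''_in; rewrite !mem_growth_words; lia.
Qed.

(** Agrees with the value 0 that [swrec_gf] prescribes in degrees below [k]. *)
Lemma growth_words_oversize n k : n < k -> growth_words n k = [::].
Proof.
elim: n k => [|n IHn] [|k] //= lt_nk.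
by rewrite IHn // IHn // ltnW.
Qed.

Lemma is_record_rcons_size w a : is_record (rcons w a) (size w) = all (ltn^~ a) w.
Proof.
rewrite /is_record nth_rcons ltnn eqxx.
apply/forallP/(all_nthP 0) => [rec i lt_i|rec i].
  by have := rec (Ordinal lt_i); rewrite nth_rcons /= lt_i.
by rewrite nth_rcons ltn_ord; apply: rec.
Qed.

Lemma swrec_rcons w a :
  swrec (rcons w a) =
  swrec w + (if all (ltn^~ a) w then (size w).+1 * a else 0).
Proof.
rewrite /swrec size_rcons big_mkcond big_ord_recr /= is_record_rcons_size.
rewrite nth_rcons ltnn eqxx; congr addn.
rewrite [RHS]big_mkcond; apply: eq_bigr => i _ /=.
rewrite nth_rcons ltn_ord; congr (if _ then _ else _).
(* Being a record depends only on the letters up to that position, which the appended letter does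
   not change. *)
rewrite /is_record nth_rcons ltn_ord; apply: eq_forallb => j.
by rewrite nth_rcons (ltn_trans (ltn_ord j)).
Qed.

Lemma swrec_rcons_new w k :
  max_letter w = k -> swrec (rcons w k.+1) = swrec w + (size w).+1 * k.+1.
Proof.
move=> <-; rewrite swrec_rcons ifT //.
by apply/allP => a /leq_max_letter.
Qed.

Lemma swrec_rcons_old w a :
  growth_word w -> 0 < a <= max_letter w -> swrec (rcons w a) = swrec w.
Proof.
move=> gw; rewrite -growth_word_mem // => w_a.
rewrite swrec_rcons ifF ?addn0 //; apply/allP => /(_ a w_a).
by rewrite /= ltnn.
Qed.

End RestrictedGrowth.

(** * Canonical forms of set partitions are exactly the growth words *)

Section CanonicalForm.
Local Open Scope nat_scope.
Variables (n : nat).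
Implicit Types (P : {set {set 'I_n}}) (B C : {set 'I_n}) (i j : 'I_n).

Lemma block_min_le B i : i \in B -> block_min B <= i.
Proof.
move=> Bi; rewrite /block_min; have := mem_index_enum i.
elim: (index_enum _) => // j r IHr; rewrite inE big_cons.
case/orP=> [/eqP<-|/IHr le_i]; first by rewrite Bi geq_minl.
by case: ifP => // _; rewrite (leq_trans (geq_minr _ _)).
Qed.

Lemma block_minP B : B != set0 -> exists2 i, i \in B & block_min B = i.
Proof.
case/set0Pn=> i0 Bi0.
(* The fold starts from [n], which exceeds every element and so cannot be the minimum of a nonempty
   block. *)
have : block_min B = n \/ exists2 i, i \in B & block_min B = i.
  apply: (big_ind (fun m => m = n \/ exists2 i, i \in B & m = i)); first by left.
    by move=> a b ha hb; rewrite /minn; case: ifP.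
  by move=> i Bi; right; exists i.
case=> // eq_n; have := block_min_le _ _ Bi0.
by rewrite eq_n leqNgt ltn_ord.
Qed.

Section Fixed.
Variable P : {set {set 'I_n}}.
Hypothesis partP : partition P [set: 'I_n].

Let coverP : cover P = [set: 'I_n]. Proof. exact: cover_partition partP. Qed.
Let trivP : trivIset P. Proof. by case/and3P: partP. Qed.

Lemma mem_blocks B : (B \in blocks P) = (B \in P).
Proof. by rewrite mem_sort mem_enum. Qed.

Lemma size_blocks : size (blocks P) = #|P|.
Proof. by rewrite size_sort cardE. Qed.

Lemma pblock_blocks i : pblock P i \in blocks P.
Proof. by rewrite mem_blocks pblock_mem // coverP inE. Qed.

Lemma mem_pblock_partition i : i \in pblock P i.
Proof. by rewrite mem_pblock coverP inE. Qed.

Lemma size_canonical_form Q : size (@canonical_form n Q) = n.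
Proof. by rewrite size_map size_enum_ord. Qed.

Lemma nth_canonical_form i :
  nth 0 (canonical_form P) i = (index (pblock P i) (blocks P)).+1.
Proof. by rewrite (nth_map i) ?size_enum_ord // nth_ord_enum. Qed.

(** [index] is injective on the listed blocks, so the coincidences among letters record which
    positions share a block. *)
Lemma canonical_form_kernel i j :
  (nth 0 (canonical_form P) i == nth 0 (canonical_form P) j)
  = (pblock P i == pblock P j).
Proof.
rewrite !nth_canonical_form eqSS; apply/eqP/eqP => [eq_idx|-> //].
by apply: (index_inj set0) eq_idx; apply: pblock_blocks.
Qed.

Lemma nth_blocks_min m1 m2 :
  m1 <= m2 < #|P| ->
  block_min (nth set0 (blocks P) m1) <= block_min (nth set0 (blocks P) m2).
Proof.
case/andP=> le_m lt_m.
pose le_min := fun A B : {set 'I_n} => block_min A <= block_min B.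
have tr : transitive le_min by move=> A B C; apply: leq_trans.
have rf : reflexive le_min by move=> A; apply: leqnn.
apply: (sorted_leq_nth tr rf set0 _ _ _ _ _ le_m);
  rewrite ?inE ?size_blocks ?(leq_ltn_trans le_m) //.
by apply: sort_sorted => A B; apply: leq_total.
Qed.

(* The witness [j] is the minimum of the [m]-th block. *)
Lemma canonical_form_reaches m i :
    m < index (pblock P i) (blocks P) ->
  exists2 j : 'I_n, j < i & nth 0 (canonical_form P) j = m.+1.
Proof.
move=> lt_m; have lt_i : index (pblock P i) (blocks P) < #|P|.
  by rewrite -size_blocks index_mem pblock_blocks.
have lt_mP : m < size (blocks P) by rewrite size_blocks; lia.
set C := nth set0 (blocks P) m.
have PC : C \in P by rewrite -mem_blocks mem_nth.
have idxC : index C (blocks P) = m.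
  by rewrite index_uniq // sort_uniq enum_uniq.
have /block_minP[j Cj min_j] : C != set0.
  by apply: contraTneq PC => ->; case/and3P: partP.
have pCj : pblock P j = C by apply: def_pblock.
exists j; last by rewrite nth_canonical_form pCj idxC.
(* As the blocks are sorted, the minimum of [C] is at most that of the block of [i], hence at most
   [i]. *)
have : j <= i.
  rewrite -min_j; apply: leq_trans (block_min_le _ _ (mem_pblock_partition i)).
  rewrite -(nth_index set0 (pblock_blocks i)).
  by apply: nth_blocks_min; rewrite ltnW.
rewrite leq_eqVlt => /orP[/eqP/val_inj eq_ji|//].
by move: lt_m; rewrite -eq_ji pCj idxC ltnn.
Qed.

(** Every letter above 1 is preceded by an occurrence of its predecessor, so it exceeds the maximum
    of its prefix by at most one. *)
Lemma growth_word_canonical_form : growth_word (canonical_form P).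
Proof.
apply/allP => m; rewrite mem_iota size_canonical_form /= add0n => lt_m.
rewrite (nth_canonical_form (Ordinal lt_m)) /=.
case def_v: (index _ _) => [|v] //.
have [|j lt_j eq_j] := @canonical_form_reaches v (Ordinal lt_m).
  by rewrite def_v.
rewrite /= ltnS; apply: leq_max_letter; rewrite -eq_j -(nth_take 0 lt_j) mem_nth //.
by rewrite size_take size_canonical_form lt_m.
Qed.

Lemma max_letter_canonical_form : max_letter (canonical_form P) = #|P|.
Proof.
apply/eqP; rewrite eqn_leq; apply/andP; split.
  apply/bigmax_leqP_seq => _ /mapP[i _ ->] _.
  by rewrite -size_blocks index_mem pblock_blocks.
(* Any element of the last block carries the letter [#|P|]. *)
case def_k: #|P| => [//|k]; apply: leq_max_letter.
have lt_k : k < size (blocks P) by rewrite size_blocks def_k.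
set C := nth set0 (blocks P) k.
have PC : C \in P by rewrite -mem_blocks mem_nth.
have /set0Pn[i Ci] : C != set0.
  by apply: contraTneq PC => ->; case/and3P: partP.
apply/mapP; exists i; first by rewrite mem_enum.
by rewrite (def_pblock trivP PC Ci) index_uniq // sort_uniq enum_uniq.
Qed.

Lemma partition_pblocks : P = [set pblock P i | i : 'I_n].
Proof.
apply/setP => B; apply/idP/imsetP => [PB|[i _ ->]].
  have /set0Pn[i Bi] : B != set0.
    by apply: contraTneq PB => ->; case/and3P: partP.
  by exists i => //; rewrite (def_pblock trivP PB Bi).
by rewrite pblock_mem // coverP inE.
Qed.

End Fixed.

(** A partition is the set of blocks of its points, and the coincidences among letters determine
    these blocks. *)
Lemma canonical_form_inj k :
  {in partitions n k &, injective (@canonical_form n)}.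
Proof.
move=> P Q; rewrite !inE => /andP[partP _] /andP[partQ _] eq_c.
rewrite (partition_pblocks _ partP) (partition_pblocks _ partQ).
apply: eq_imset => i; apply/setP => j.
have ker R' (partR : partition R' [set: 'I_n]) :
    (j \in pblock R' i) = (pblock R' i == pblock R' j).
  by rewrite eq_pblock ?(cover_partition partR) ?inE //; case/and3P: partR.
by rewrite !ker // -!canonical_form_kernel // eq_c.
Qed.

(** Group positions by their letter in [w]: the canonical form of this partition has the same
    coincidences as [w], and both are growth words. *)
Lemma canonical_form_surj w :
    growth_word w -> size w = n ->
  exists2 P, partition P [set: 'I_n] & canonical_form P = w.
Proof.
move=> gw sz_w; pose f (i : 'I_n) := nth 0 w i.
exists (preim_partition f [set: 'I_n]); first exact: preim_partitionP.
have partP := preim_partitionP f [set: 'I_n].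
apply: growth_word_eq; rewrite ?size_canonical_form //.
  exact: growth_word_canonical_form.
move=> i j lt_i lt_j.
rewrite (canonical_form_kernel _ partP (Ordinal lt_i) (Ordinal lt_j)).
rewrite eq_pblock ?(cover_partition partP) ?inE //; last by case/and3P: partP.
rewrite pblock_equivalence_partition ?inE //.
by apply: in3W; split=> // /eqP->.
Qed.

Lemma perm_canonical_forms k :
  perm_eq [seq canonical_form P | P <- enum (partitions n k)]
          (growth_words n k).
Proof.
apply: uniq_perm; last 1 first.
- move=> w; rewrite mem_growth_words; apply/mapP/and3P => [[P]|[gw sz_w mx_w]].
    rewrite mem_enum inE => /andP[partP /eqP<-] ->.
    by rewrite growth_word_canonical_form // size_canonical_form
               max_letter_canonical_form.
  have [P partP eq_w] := canonical_form_surj _ gw (eqP sz_w).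
  exists P => //; rewrite mem_enum inE partP -(eqP mx_w) -eq_w.
  by rewrite max_letter_canonical_form /=.
- rewrite map_inj_in_uniq ?enum_uniq // => P Q; rewrite !mem_enum.
  exact: canonical_form_inj.
exact: growth_words_uniq.
Qed.

End CanonicalForm.

(** * The recursion for the generating functions *)

Lemma coef_swrec_gf k n :
  fps_coef (swrec_gf k) n = \sum_(w <- growth_words n k) 'X^(swrec w).
Proof.
rewrite /=; case: leqP => [_|lt_nk].
  by rewrite -(perm_big _ (perm_canonical_forms n k)) big_map big_enum.
by rewrite growth_words_oversize // big_nil.
Qed.

Lemma coef_swrec_gfS k n :
  fps_coef (swrec_gf k.+1) n.+1 =
  'X^(n.+1 * k.+1) * fps_coef (swrec_gf k) n
  + k.+1%:R * fps_coef (swrec_gf k.+1) n.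
Proof.
rewrite !coef_swrec_gf growth_wordsSS big_cat big_map big_allpairs_dep !mulr_sumr.
congr (_ + _); apply: eq_big_seq => w; rewrite mem_growth_words.
  case/and3P=> _ /eqP sz_w /eqP mx_w.
  by rewrite swrec_rcons_new // sz_w exprD mulrC.
case/and3P=> gw _ /eqP mx_w.
(* An old letter is no record, so all [k.+1] choices give the same monomial. *)
transitivity (\sum_(a <- iota 1 k.+1) 'X^(swrec w) : {poly int}).
  apply: eq_big_seq => a; rewrite mem_iota => ha.
  by rewrite swrec_rcons_old // mx_w; lia.
by rewrite big_const_seq count_predT size_iota iter_addr_0 mulr_natl.
Qed.

Lemma swrec_gf0 : swrec_gf 0 = 1.
Proof.
apply/fpsP => n; rewrite coef_swrec_gf.
have w0 m : growth_words m.+1 0 = [::].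
  by rewrite /=; elim: (growth_words m 0).
case: n => [|n]; last by rewrite w0 big_nil.
by rewrite big_seq1 /swrec big_ord0.
Qed.

(** The weight q^((n+1)(k+1)) of a final record is q^(k+1) times (q^(k+1))^n, and the second factor
    is the substitution of x q^(k+1) for x. *)
Lemma swrec_gf_rec k :
  swrec_gf k.+1 * (1 - k.+1%:R * fpsX) =
  fpsX * fpsC 'X ^+ k.+1 * fps_scale _ ('X^(k.+1)) (swrec_gf k).
Proof.
apply/eqP; rewrite mulrBr mulr1 subr_eq addrC; apply/eqP/fpsP => n.
rewrite -(rmorph_nat (@fpsC _)) -rmorphXn -mulrA.
rewrite [_ * (_ * fpsX)]mulrC -[_ * fpsX * _]mulrA coef_fpsD coef_fpsCM.
rewrite !coef_fpsXM; case: n => [|n].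
  by rewrite coef_swrec_gf big_nil mulr0 addr0.
rewrite coef_swrec_gfS addrC coef_fpsCM /= mulrA -exprM -exprD.
by rewrite -mulnS mulnC.
Qed.

(** * The product formula *)

(** Total exponents of q in the numerators after the substitution and in the formula for k + 1.
    After reversal the terms differ by k + 1 - 2i, which sums to 0 over i from 1 to k. *)
Lemma sum_pronic_shift k :
  (\sum_(1 <= i < k.+1) (k.+1 + (k + 1 - i) * (k - i)) =
   \sum_(1 <= i < k.+1) (k.+1 + 1 - i) * (k.+1 - i))%N.
Proof.
rewrite big_nat_rev [RHS]big_nat_rev /=.
transitivity (\sum_(1 <= i < k.+1) (k.+1 + i * i.-1))%N.
  by apply: eq_big_nat => i /andP[i_gt0 lt_i]; congr (_ + _ * _)%N; lia.
transitivity (\sum_(1 <= i < k.+1) (i.+1 * i))%N; last first.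
  by apply: eq_big_nat => i /andP[i_gt0 lt_i]; congr (_ * _)%N; lia.
rewrite big_split /= sum_nat_const_nat subn1 /=.
elim: k => [|k IHk]; first by rewrite !big_geq.
by rewrite big_nat_recr // [RHS]big_nat_recr //= -IHk; lia.
Qed.

Theorem theorem1 (k : nat) (k_ge1 : (1 <= k)%N) :
  let x : fps {poly int} := fpsX in
  let q : fps {poly int} := fpsC 'X in
  swrec_gf k =
    \prod_(1 <= i < k.+1)
      (x * q ^+ i * q ^+ ((k + 1 - i) * (k - i))
       / (1 - i%:R * x * \prod_(i.+1 <= j < k.+1) q ^+ j)).
Proof.
move=> x q; elim: k {k_ge1} => [|k IHk]; first by rewrite big_geq // swrec_gf0.
have den_unit i e : 1 - i%:R * x * q ^+ e \is a GRing.unit.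
  rewrite mulrAC -(rmorph_nat (@fpsC _)) -rmorphXn -rmorphM.
  exact: geom_fps_unit.
have den_unit1 : 1 - k.+1%:R * x \is a GRing.unit.
  by have := den_unit k.+1 0%N; rewrite expr0 mulr1.
(* The factor for i = k + 1 is just x q^(k+1) / (1 - (k+1) x), so it cancels against the
   recursion. *)
apply: (mulIr den_unit1); rewrite swrec_gf_rec big_nat_recr //=.
rewrite [\prod_(k.+2 <= _ < _) _]big_geq // mulr1 subnn muln0 expr0 mulr1.
rewrite -[RHS]mulrA divrK // [RHS]mulrC; congr (_ * _).
rewrite IHk rmorph_prod.
have scale_q e : fps_scale _ ('X^(k.+1)) (q ^+ e) = q ^+ e.
  by rewrite -rmorphXn fps_scaleC.
have scale_x : fps_scale _ ('X^(k.+1)) x = q ^+ k.+1 * x.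
  by rewrite fps_scaleX rmorphXn.
pose D i := (1 - i%:R * x * \prod_(i.+1 <= j < k.+2) q ^+ j)^-1.
(* The substitution gives each denominator the missing factor q^(k+1), so denominators match one by
   one; each numerator gains q^(k+1). *)
transitivity (\prod_(1 <= i < k.+1)
    (x * q ^+ i * D i * q ^+ (k.+1 + (k + 1 - i) * (k - i)))).
  apply: eq_big_nat => i /andP[_ lt_i].
  rewrite prodrXr rmorphM rmorphV ?den_unit // !rmorphM /= scale_x !scale_q.
  rewrite rmorphB rmorph1 !rmorphM rmorph_nat /= scale_x scale_q /D.
  rewrite [\prod_(_ <= _ < k.+2) _]big_nat_recr //= prodrXr exprD.
  have -> : i%:R * (q ^+ k.+1 * x) * q ^+ (\sum_(i.+1 <= j < k.+1) j)
            = i%:R * x * (q ^+ (\sum_(i.+1 <= j < k.+1) j) * q ^+ k.+1) by ring.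
  by ring.
(* The numerators agree only in total: their powers of q are merged into one, compared, and
   distributed again. *)
rewrite big_split /= prodrXr sum_pronic_shift -prodrXr -big_split /=.
by apply: eq_bigr => i _; rewrite mulrAC.
Qed.
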